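(* Let $\mathbb{Q}^{+}$ be ordered by the Calkin-Wilf tree enumeration $q_1,q_2,q_3,\dots$. Then $\mathbb{Q}^{+}$ is partitioned into the three parity classes $\mathbb{Q}_\mathrm{E}^{+}$, $\mathbb{Q}_\mathrm{O}^{+}$ and $\mathbb{Q}_\mathrm{N}^{+}$, and each of these has asymptotic density $\frac{1}{3}$ in $\mathbb{Q}^+$ with respect to this ordering.
   Context: Write each rational in lowest terms $m/n$ with $n>0$, $\gcd(m,n)=1$. Its parity is: even if $m$ is even (hence $n$ odd); odd if $m$ and $n$ are both odd; none if $n$ is even (hence $m$ odd). $\mathbb{Q}_\mathrm{E}^{+},\mathbb{Q}_\mathrm{O}^{+},\mathbb{Q}_\mathrm{N}^{+}$ are the sets of positive rationals of parity even, odd, none respectively. The Calkin-Wilf tree is the infinite binary tree with root $1/1$ in which each vertex $m/n$ has left child $m/(m+n)$ and right child $(m+n)/n$; every positive rational occurs exactly once. The Calkin-Wilf enumeration lists the tree row by row (row $0$ is the root, row $r$ has $2^r$ entries), each row from left to right. For a countable set $X$ enumerated as $x_1,x_2,\dots$ and $A\subseteq X$, the asymptotic density of $A$ in $X$ is $\rho_X(A)=\lim_{n\to\infty}|A\cap\{x_1,\dots,x_n\}|/n$ when the limit exists. *)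

(* Defs.v *)
From HB Require Import structures.
From mathcomp Require Import all_boot all_order all_algebra.
From mathcomp Require Import finmap.
From mathcomp Require Import all_classical all_reals all_analysis.
From mathcomp Require Import zify ring lra.

Set Implicit Arguments.
Unset Strict Implicit.
Unset Printing Implicit Defensive.

Import Order.TTheory GRing.Theory Num.Theory.
Import numFieldNormedType.Exports.

Local Open Scope classical_set_scope.
Local Open Scope ring_scope.

Definition Qpos : set rat := [set q | 0 < q].

Inductive parity := Even | Odd | Nopar.

(* [numq q] and [denq q] are the coprime numerator and positive denominator. *)
Definition has_parity (p : parity) (q : rat) : Prop :=
  match p with
  | Even => (2 %| numq q)%Z
  | Odd => ~~ (2 %| numq q)%Z && ~~ (2 %| denq q)%Z
  | Nopar => (2 %| denq q)%Z
  end.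

Definition Qpos_parity (p : parity) : set rat := Qpos `&` has_parity p.

Definition cw_left (q : rat) : rat := (numq q)%:Q / (numq q + denq q)%:Q.
Definition cw_right (q : rat) : rat := (numq q + denq q)%:Q / (denq q)%:Q.

Definition cw_children (s : seq rat) : seq rat :=
  flatten [seq [:: cw_left q; cw_right q] | q <- s].

Definition cw_row (r : nat) : seq rat := iter r cw_children [:: 1].

Definition cw_rows (r : nat) : seq rat := flatten (mkseq cw_row r).

(* Indexing starts at 0: [cw n] is the (n+1)-st entry of the enumeration. It
   lies in the first n+1 rows, which have 2 ^ n.+1 - 1 > n entries. *)
Definition cw (n : nat) : rat := nth 0 (cw_rows n.+1) n.

(* [x] enumerates the infinite set [X] without repetition, from index 0. *)
Definition has_density (R : realType) (T : choiceType) (X : set T)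
    (x : {bij [set: nat] >-> X}) (A : set T) (l : R) : Prop :=
  (#|` fset_set (A `&` x @` `I_n) |)%:R / n%:R @[n --> \oo] --> l.

Lemma size_cw_children s : size (cw_children s) = (size s).*2.
Proof. by elim: s => //= q s; rewrite /cw_children /= => ->. Qed.

Lemma size_cw_row r : size (cw_row r) = (2 ^ r)%N.
Proof. by elim: r => //= r IH; rewrite size_cw_children IH expnS mul2n. Qed.

Lemma cw_rowsS r : cw_rows r.+1 = cw_rows r ++ cw_row r.
Proof. by rewrite /cw_rows mkseqS flatten_rcons. Qed.

Lemma size_cw_rows r : (size (cw_rows r)).+1 = (2 ^ r)%N.
Proof.
elim: r => // r IH.
by rewrite cw_rowsS size_cat size_cw_row -addSn IH expnS mul2n addnn.
Qed.

Lemma nth_cw_children s i : (i < size s)%N ->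
  nth 0 (cw_children s) i.*2 = cw_left (nth 0 s i) /\
  nth 0 (cw_children s) i.*2.+1 = cw_right (nth 0 s i).
Proof. by elim: s i => [|q s IH] [|i] //= /IH. Qed.

Lemma nth_cw_rows r s n : (n < size (cw_rows r))%N -> (r <= s)%N ->
  nth 0 (cw_rows s) n = nth 0 (cw_rows r) n.
Proof.
move=> nr /subnKC <-; elim: (s - r)%N => [|k IH]; first by rewrite addn0.
rewrite addnS cw_rowsS nth_cat IH ifT//.
apply: leq_trans nr _; rewrite -ltnS !size_cw_rows leq_exp2l//; lia.
Qed.

Lemma cw_nth_row r i : (i < 2 ^ r)%N -> cw (2 ^ r + i).-1 = nth 0 (cw_row r) i.
Proof.
move=> ir; have := size_cw_rows r; have := size_cw_rows r.+1.
rewrite expnS => S1 S0.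
have L : (2 ^ r + i).-1 = (size (cw_rows r) + i)%N by lia.
have := @ltn_expl 2 (2 ^ r + i).-1.+1 erefl => L2.
have := size_cw_rows (2 ^ r + i).-1.+1 => S2.
rewrite /cw; transitivity (nth 0 (cw_rows r.+1) (2 ^ r + i).-1).
  have [le|lt] := leqP r.+1 (2 ^ r + i).-1.+1.
    by apply: nth_cw_rows => //; lia.
  by symmetry; apply: nth_cw_rows; lia.
by rewrite cw_rowsS nth_cat L ltnNge leq_addr /= addKn.
Qed.

Lemma cw0 : cw 0 = 1.
Proof. by []. Qed.

Lemma cw_child n : cw n.*2.+1 = cw_left (cw n) /\ cw n.*2.+2 = cw_right (cw n).
Proof.
have /andP[lo hi] := @trunc_log_bounds 2 n.+1 erefl erefl.
set r := trunc_log 2 n.+1 in lo hi; pose i := (n.+1 - 2 ^ r)%N.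
rewrite expnS in hi.
have ir : (i < 2 ^ r)%N by lia.
have -> : n.*2.+1 = (2 ^ r.+1 + i.*2).-1 by rewrite expnS; lia.
have -> : (2 ^ r.+1 + i.*2).-1.+1 = (2 ^ r.+1 + i.*2.+1).-1.
  by rewrite expnS; lia.
have -> : n = (2 ^ r + i).-1 by lia.
rewrite !cw_nth_row ?expnS//; [|lia|lia].
by have := @nth_cw_children (cw_row r) i; rewrite size_cw_row => /(_ ir).
Qed.

Lemma cw_leftE q : 0 < q -> cw_left q = q / (q + 1).
Proof.
move=> q0; rewrite /cw_left -[q in RHS]divq_num_den rmorphD/=.
have d0 : 0 < (denq q)%:Q by rewrite ltr0z denq_gt0.
have n0 : 0 < (numq q)%:Q by rewrite ltr0z numq_gt0.
by field; rewrite ?gt_eqF ?addr_gt0.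
Qed.

Lemma cw_rightE q : cw_right q = q + 1.
Proof.
rewrite /cw_right -[q in RHS]divq_num_den rmorphD/=.
have d0 : 0 < (denq q)%:Q by rewrite ltr0z denq_gt0.
by field; rewrite gt_eqF.
Qed.

Lemma cw_ind (P : nat -> Prop) : P 0 ->
  (forall n, P n -> P n.*2.+1) -> (forall n, P n -> P n.*2.+2) ->
  forall n, P n.
Proof.
move=> P0 Pl Pr; elim/ltn_ind => -[//|n] IH.
have := odd_double_half n; case: (odd n) => /= nE.
  have -> : n.+1 = n./2.*2.+2 by lia.
  by apply: Pr; apply: IH; lia.
have -> : n.+1 = n./2.*2.+1 by lia.
by apply: Pl; apply: IH; lia.
Qed.

Lemma cw_gt0 n : 0 < cw n.
Proof.
elim/cw_ind: n => [|n IH|n IH]; first by rewrite cw0.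
  by rewrite (cw_child n).1 cw_leftE// divr_gt0// addr_gt0.
by rewrite (cw_child n).2 cw_rightE addr_gt0.
Qed.

Lemma cw_left_lt1 n : cw n.*2.+1 < 1.
Proof.
have q0 := cw_gt0 n; rewrite (cw_child n).1 cw_leftE//.
by rewrite ltr_pdivrMr ?addr_gt0// mul1r ltrDl.
Qed.

Lemma cw_right_gt1 n : 1 < cw n.*2.+2.
Proof. by rewrite (cw_child n).2 cw_rightE ltrDr cw_gt0. Qed.

Lemma cw_inj : injective cw.
Proof.
elim/cw_ind => [|n IH|n IH]; elim/cw_ind => [|m _|m _] //= E.
- by have := cw_left_lt1 m; rewrite -E cw0 ltxx.
- by have := cw_right_gt1 m; rewrite -E cw0 ltxx.
- by have := cw_left_lt1 n; rewrite E cw0 ltxx.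
- have n0 := cw_gt0 n; have m0 := cw_gt0 m.
  congr (_.*2.+1); apply: IH; move: E.
  rewrite (cw_child n).1 (cw_child m).1 !cw_leftE// => /eqP.
  rewrite eqr_div ?lt0r_neq0 ?addr_gt0// => /eqP.
  by rewrite !mulrDr !mulr1 [cw m * _]mulrC => /addrI.
- by have := cw_left_lt1 n; rewrite E => /lt_trans/(_ (cw_right_gt1 m)); rewrite ltxx.
- by have := cw_right_gt1 n; rewrite E cw0 ltxx.
- by have := cw_left_lt1 m; rewrite -E => /lt_trans/(_ (cw_right_gt1 n)); rewrite ltxx.
- congr (_.*2.+2); apply: IH; move: E.
  by rewrite (cw_child n).2 (cw_child m).2 !cw_rightE => /addIr.
Qed.

Lemma cw_surj_frac (N a b : nat) : (0 < a)%N -> (0 < b)%N -> (a + b <= N)%N ->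
  exists n, cw n = a%:R / b%:R.
Proof.
elim: N a b => [|N IH] a b a0 b0 abN; first by lia.
have a0' : 0 < a%:R :> rat by rewrite ltr0n.
have b0' : 0 < b%:R :> rat by rewrite ltr0n.
have [ab|ab|->] := ltngtP a b.
- have [||n E] := IH a (b - a)%N a0; [lia|lia|].
  have c0 : 0 < (b - a)%:R :> rat by rewrite ltr0n; lia.
  exists n.*2.+1; rewrite (cw_child n).1 cw_leftE ?cw_gt0// E.
  have -> : b%:R = a%:R + (b - a)%:R :> rat by rewrite -natrD; congr _%:R; lia.
  by field; rewrite ?gt_eqF ?addr_gt0.
- have [||n E] := IH (a - b)%N b _ b0; [lia|lia|].
  exists n.*2.+2; rewrite (cw_child n).2 cw_rightE E natrB 1?ltnW//.
  by field; rewrite gt_eqF.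
- by exists 0%N; rewrite cw0 divff// gt_eqF.
Qed.

Lemma cw_bij : set_bij [set: nat] Qpos cw.
Proof.
split=> [n _|n m _ _|q q0]; [exact: cw_gt0|exact: cw_inj|].
have n0 : 0 < numq q by rewrite numq_gt0.
have [||//|n E] := @cw_surj_frac (`|numq q| + `|denq q|)%N `|numq q|%N `|denq q|%N.
- by rewrite absz_gt0 gt_eqF.
- by rewrite absz_gt0 denq_neq0.
exists n => //; rewrite E -[RHS]divq_num_den.
by rewrite !pmulrn !gez0_abs ?ltW ?denq_gt0.
Qed.

HB.instance Definition _ := isFun.Build _ _ [set: nat] Qpos cw (set_bij_homo cw_bij).
HB.instance Definition _ : OCanV _ _ [set: nat] Qpos cw := set_bij_surj cw_bij.
HB.instance Definition _ :=
  SurjFun_Inj.Build _ _ [set: nat] Qpos cw (set_bij_inj cw_bij).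

(* Main.v *)
(** Write [E], [O], [N] for the three classes. The children of a vertex of class
    [E], [O], [N] have classes [E, O], [N, E], [O, N] respectively, so each class
    is avoided by the children of exactly one class. Hence the deviation
    [D_p(n) = 3 #{i < n | q_i in p} - n] satisfies
    [|D_p(n)| <= |D_p'(m)| + 4] for some [p'], where [m] is about [n / 2]; so
    [D_p(n)] grows at most logarithmically. *)
Require Import Defs.
From mathcomp Require Import all_boot all_order all_algebra.
From mathcomp Require Import finmap.
From mathcomp Require Import all_classical all_reals all_analysis.
From mathcomp Require Import zify ring lra.

Set Implicit Arguments.
Unset Strict Implicit.
Unset Printing Implicit Defensive.

Import Order.TTheory GRing.Theory Num.Theory.
Import numFieldNormedType.Exports.

Local Open Scope classical_set_scope.
Local Open Scope ring_scope.

(** By injectivity [x n] is new, so each step adds exactly its indicator. This turns the cardinality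
    in [has_density] into a sum. *)
Lemma card_fset_set_image_II (T : choiceType) (x : nat -> T) (A : set T) n :
  injective x ->
  #|` fset_set (A `&` x @` `I_n)| = (\sum_(i < n) `[< A (x i) >])%N.
Proof.
move=> xI; elim: n => [|n IH].
  by rewrite II0 image_set0 setI0 fset_set0 big_ord0 cardfs0.
have fin : finite_set (A `&` x @` `I_n).
  by apply: finite_setIr; apply: finite_image.
rewrite big_ord_recr/= -IH IIS image_setU image_set1 setIUr.
case: asboolP => Ax; last first.
  rewrite addn0 (_ : A `&` [set x n] = set0) ?setU0//.
  by apply/seteqP; split => y // -[+ yx]; rewrite yx => /Ax.
rewrite (_ : A `&` [set x n] = [set x n]); last first.
  by apply/seteqP; split => y [] //= ->.
rewrite fset_setU// fset_set1 fsetUC cardfsU1 addnC in_fset_set//.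
rewrite (_ : _ \notin _ = true)//; apply/negP; rewrite inE.
by move=> -[_ [k /= + /xI kn]]; rewrite kn ltnn.
Qed.

(** Splits off the root and groups the other indices into pairs of siblings with parent [i]. *)
Lemma sum_ord_double (f : nat -> nat) m :
  (\sum_(i < m.*2.+1) f i = f 0 + \sum_(i < m) (f i.*2.+1 + f i.*2.+2))%N.
Proof.
elim: m => [|m IH]; first by rewrite big_ord_recr !big_ord0 addnC.
by rewrite doubleS 2!big_ord_recr/= IH [in RHS]big_ord_recr/= !addnA.
Qed.

(** Weakens a logarithmic bound on [k] to order sqrt(n), which is still o(n). *)
Lemma sqr_le_exp2 k : (k ^ 2 <= 2 ^ k.+1)%N.
Proof.
(* (j+1)^2 <= 2 j^2 holds only from j = 3 on; smaller cases are computed. *)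
elim: k => // -[|[|[|k]]] // IH.
by move: IH; rewrite !(expnS 2 _.+4); nia.
Qed.

(** gcd(a, a + b) = gcd(a, b), so the defining fraction is already in lowest terms. *)
Lemma numq_denq_cw_left q : 0 < q ->
  numq (cw_left q) = numq q /\ denq (cw_left q) = numq q + denq q.
Proof.
move=> q0; have n0 : 0 < numq q by rewrite numq_gt0.
have d0 := denq_gt0 q.
have co : coprime (absz (numq q)) (absz (numq q + denq q)).
  have -> : absz (numq q + denq q) = (absz (numq q) + absz (denq q))%N by lia.
  by rewrite /coprime gcdnDl; exact: coprime_num_den.
rewrite /cw_left coprimeq_num// coprimeq_den//.
by rewrite gtr0_sg ?mul1r ?gt_eqF ?gtr0_norm ?addr_gt0.
Qed.

Lemma numq_denq_cw_right q : 0 < q ->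
  numq (cw_right q) = numq q + denq q /\ denq (cw_right q) = denq q.
Proof.
move=> q0; have n0 : 0 < numq q by rewrite numq_gt0.
have d0 := denq_gt0 q.
have co : coprime (absz (numq q + denq q)) (absz (denq q)).
  have -> : absz (numq q + denq q) = (absz (numq q) + absz (denq q))%N by lia.
  by rewrite /coprime gcdnC gcdnDr gcdnC; exact: coprime_num_den.
rewrite /cw_right coprimeq_num// coprimeq_den//.
by rewrite gtr0_sg ?mul1r ?gt_eqF ?gtr0_norm.
Qed.

Lemma numq_denq_not_even q : ~~ ((2 %| numq q)%Z && (2 %| denq q)%Z).
Proof.
apply/negP => /andP[n2 d2]; have /eqP co := coprime_num_den q.
have : (2 %| gcdn `|numq q| `|denq q|)%N by rewrite dvdn_gcd; lia.
by rewrite co.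
Qed.

(* Both maps are involutions: [left_parity p] is the class of the left child
   of a vertex of class [p], and also the class of the parent of a left child
   of class [p]; similarly for [right_parity]. *)
Definition left_parity p :=
  match p with Even => Even | Odd => Nopar | Nopar => Odd end.

Definition right_parity p :=
  match p with Even => Odd | Odd => Even | Nopar => Nopar end.

Lemma has_parity_cw_left p q : 0 < q ->
  has_parity p (cw_left q) <-> has_parity (left_parity p) q.
Proof.
move=> /numq_denq_cw_left[nE dE]; have := numq_denq_not_even q.
by case: p => /=; rewrite ?nE ?dE; lia.
Qed.

Lemma has_parity_cw_right p q : 0 < q ->
  has_parity p (cw_right q) <-> has_parity (right_parity p) q.
Proof.
move=> /numq_denq_cw_right[nE dE]; have := numq_denq_not_even q.
by case: p => /=; rewrite ?nE ?dE; lia.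
Qed.

Lemma has_parity_total q : exists p, has_parity p q.
Proof.
case n2 : (2 %| numq q)%Z; first by exists Even.
case d2 : (2 %| denq q)%Z; first by exists Nopar.
by exists Odd; rewrite /= n2 d2.
Qed.

Lemma has_parity_uniq p p' q : has_parity p q -> has_parity p' q -> p = p'.
Proof.
have := numq_denq_not_even q.
by case: p; case: p' => //=; lia.
Qed.

Lemma sum_has_parity q :
  (`[< has_parity Even q >] + `[< has_parity Odd q >]
   + `[< has_parity Nopar q >] = 1)%N.
Proof.
have [p pq] := has_parity_total q.
have E p' : `[< has_parity p' q >] = `[< p' = p >].
  by apply: asbool_equiv_eq; split=> [/has_parity_uniq/(_ pq)|->].
by rewrite !E; case: p {pq E}; do !case: asboolP.
Qed.

Definition parity_count p n := (\sum_(i < n) `[< has_parity p (cw i) >])%N.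

Lemma sum_parity_count n :
  (parity_count Even n + parity_count Odd n + parity_count Nopar n = n)%N.
Proof.
rewrite /parity_count -!big_split/=.
by under eq_bigr do rewrite sum_has_parity; rewrite sum1_card card_ord.
Qed.

(** Index 0 is the root 1/1, which is odd; the remaining [m.*2] indices are the children of the
    first [m] vertices, each class being pulled back to the parent. *)
Lemma parity_count_double p m :
  (parity_count p m.*2.+1 = `[< p = Odd >]
     + (parity_count (left_parity p) m + parity_count (right_parity p) m))%N.
Proof.
rewrite /parity_count (sum_ord_double (fun i => `[< has_parity p (cw i) >])).
rewrite -big_split; congr (_ + _)%N.
  congr nat_of_bool; apply: asbool_equiv_eq; rewrite cw0.
  by split=> [/has_parity_uniq|->//]; exact.
apply: eq_bigr => i _; have [-> ->] := cw_child i.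
have q0 := cw_gt0 i.
by congr (nat_of_bool _ + nat_of_bool _)%N; apply: asbool_equiv_eq;
  [exact: has_parity_cw_left|exact: has_parity_cw_right].
Qed.

Lemma parity_countS p n :
  (parity_count p n <= parity_count p n.+1 <= (parity_count p n).+1)%N.
Proof. by rewrite /parity_count big_ord_recr/=; case: asbool; lia. Qed.

(** One [k] serves all classes, since the induction step for [p] uses the bound for another
    class. *)
Lemma parity_count_dev n : exists k, (2 ^ k <= n.+1)%N /\
  forall p, (3 * parity_count p n <= n + 4 * k)%N /\
            (n <= 3 * parity_count p n + 4 * k)%N.
Proof.
elim/cw_ind: n => [|m [k [km D]]|m [k [km D]]].
- by exists 0%N; split=> // p; rewrite /parity_count big_ord0.
- exists k.+1; rewrite expnS; split=> [|p]; first by lia.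
  (* [left_parity p] and [right_parity p] differ; with p' the third class, D_p(2m+1) = 3[p = Odd] -
     1 - D_p'(m), a change of at most 2 in absolute value. *)
  have := sum_parity_count m; have := parity_count_double p m.
  have := D Even; have := D Odd; have := D Nopar.
  by case: p; case: asboolP => //=; lia.
- exists k.+1; rewrite expnS; split=> [|p]; first by lia.
  have := sum_parity_count m; have := parity_count_double p m.
  have := D Even; have := D Odd; have := D Nopar.
  (* The extra index shifts the deviation by -1 or 2, hence the constant 4. *)
  have := parity_countS p m.*2.+1.
  by case: p; case: asboolP => //=; lia.
Qed.

Theorem theorem1 (R : realType) :
  partition [set: parity] Qpos_parity Qpos /\
  forall p : parity, has_density cw (Qpos_parity p) (3^-1 : R).
Proof.
split.
  split.
  - apply/seteqP; split=> [q [p _ []//]|q q0].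
    by have [p pq] := has_parity_total q; exists p.
  - by move=> p p' _ _ [q [[_ pq] [_ /(has_parity_uniq pq)]]].
  - case=> _; [exists 2|exists 1|exists (2^-1)]; by split.
move=> p; rewrite /has_density.
have cE n : #|` fset_set (Qpos_parity p `&` cw @` `I_n)| = parity_count p n.
  rewrite card_fset_set_image_II; last exact: cw_inj.
  apply: eq_bigr => i _; congr nat_of_bool; apply: asbool_equiv_eq.
  by split=> [[]//|pi]; split=> //; exact: cw_gt0.
apply/cvgrPdist_lt => e e0; near=> n.
have n0 : 0 < n%:R :> R by rewrite ltr0n; near: n; exact: nbhs_infty_gt.
(* The error is at most 4k/(3n) with k <= 2 sqrt(n), so n > 64/(9 e^2) suffices; 8 rounds 64/9
   up. *)
have ne : 8 / e ^+ 2 < n%:R by near: n; exact: nbhs_infty_gtr.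
rewrite cE; set c := parity_count p n.
have [k [kn /(_ p)[cu cl]]] := parity_count_dev n.
(* k^2 <= 2 * 2^k <= 2(n + 1) <= 4n, as n >= 1. *)
have {}kn : (k ^ 2 <= 4 * n)%N.
  have : (0 < n)%N by rewrite -(ltr0n R).
  by have := sqr_le_exp2 k; rewrite (expnS 2); lia.
have {}kn : k%:R ^+ 2 <= 4 * n%:R :> R by rewrite -natrX -natrM ler_nat.
have {}cu : 3 * c%:R <= n%:R + 4 * k%:R :> R.
  by rewrite -!natrM -natrD ler_nat.
have {}cl : n%:R <= 3 * c%:R + 4 * k%:R :> R.
  by rewrite -!natrM -natrD ler_nat.
have {}ne : 8 < e ^+ 2 * n%:R by rewrite mulrC -ltr_pdivrMr// exprn_gt0.
have dev : `|3 * c%:R - n%:R| <= 4 * k%:R :> R by rewrite ler_norml; lra.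
rewrite (_ : _ - _ = - ((3 * c%:R - n%:R) / (3 * n%:R))); last first.
  by field; rewrite gt_eqF.
rewrite normrN normrM normfV (gtr0_norm (_ : 0 < 3 * n%:R)) ?mulr_gt0//.
rewrite ltr_pdivrMr ?mulr_gt0//; apply: le_lt_trans dev _.
(* After squaring: 16 k^2 <= 64 n < 72 n < 9 e^2 n^2. *)
rewrite -ltr_sqr ?nnegrE ?mulr_ge0 ?ler0n ?ltW// !exprMn.
nra.
Unshelve. all: by end_near.
Qed.
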